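(* Suppose that $$\int_1^\infty g(\zeta)^{-1/m}\,\zeta^{1/m-1}\,d\zeta<\infty$$ and, moreover, $m\ge n$. Then any global weak solution $u$ of the inequality $\sum_{|\alpha|=m}\partial^\alpha a_\alpha(x,u)\ge g(|u|)$ in $\mathbb{R}^n$ is trivial, i.e. $u=0$ almost everywhere in $\mathbb{R}^n$.
   Context: Let $m,n\ge 1$ be integers. For each multi-index $\alpha=(\alpha_1,\dots,\alpha_n)$ with $|\alpha|=\alpha_1+\dots+\alpha_n=m$, let $a_\alpha:\mathbb{R}^n\times\mathbb{R}\to\mathbb{R}$ be a Caratheodory function (measurable in $x$ for every $\zeta$, continuous in $\zeta$ for almost every $x$) such that, for some constant $A>0$, $|a_\alpha(x,\zeta)|\le A|\zeta|$ for almost all $x\in\mathbb{R}^n$ and all $\zeta\in\mathbb{R}$. Here $\partial^\alpha=\partial^{|\alpha|}/(\partial_{x_1}^{\alpha_1}\cdots\partial_{x_n}^{\alpha_n})$. Let $g:[0,\infty)\to\mathbb{R}$ be a non-decreasing convex function with $g(\zeta)>0$ for all $\zeta>0$. A function $u\in L_{1,loc}(\mathbb{R}^n)$ (real-valued) is called a global weak solution of $\sum_{|\alpha|=m}\partial^\alpha a_\alpha(x,u)\ge g(|u|)$ in $\mathbb{R}^n$ if $g(|u|)\in L_{1,loc}(\mathbb{R}^n)$ and $$\int_{\mathbb{R}^n}\sum_{|\alpha|=m}(-1)^m a_\alpha(x,u)\,\partial^\alpha\varphi\,dx\ge\int_{\mathbb{R}^n}g(|u|)\,\varphi\,dx$$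 for every non-negative $\varphi\in C_0^\infty(\mathbb{R}^n)$. *)

(* Defs.v *)
From HB Require Import structures.
From mathcomp Require Import all_boot all_order all_algebra.
From mathcomp Require Import all_classical all_reals all_analysis.

Set Implicit Arguments.
Unset Strict Implicit.
Unset Printing Implicit Defensive.

Import Order.TTheory GRing.Theory Num.Theory.
Import numFieldNormedType.Exports.

Local Open Scope classical_set_scope.
Local Open Scope ring_scope.

Section LebesgueMeasure.
Context {R : realType} {n : nat}.
Implicit Types (X : set 'rV[R]_n) (B : 'rV[R]_n * 'rV[R]_n).

(* The pair (a, b) encodes the closed box [a_0, b_0] x ... x [a_(n-1), b_(n-1)],
   which is empty as soon as b_i < a_i for some i. *)
Definition box B : set 'rV[R]_n :=
  [set x | forall i, B.1 ord0 i <= x ord0 i <= B.2 ord0 i].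

Definition box_volume B : R :=
  \prod_(i < n) Num.max 0 (B.2 ord0 i - B.1 ord0 i).

(* Countable covers are indexed by arbitrary subsets D of nat; allowing D to be
   finite, or empty, is what makes the definition correct for n = 0 too. *)
Definition lebesgue_outer X : \bar R :=
  ereal_inf [set v | exists (D : set nat) (B : nat -> 'rV[R]_n * 'rV[R]_n),
    X `<=` \bigcup_(k in D) box (B k) /\
    v = (\esum_(k in D) (box_volume (B k))%:E)%E].

Lemma box_volume_ge0 B : 0 <= box_volume B.
Proof. by apply: prodr_ge0 => i _; rewrite le_max lexx. Qed.

Lemma lebesgue_outer_ge0 X : (0 <= lebesgue_outer X)%E.
Proof.
apply: le_ereal_inf_tmp => _ [D [B [_ ->]]].
by apply: esum_ge0 => k _; rewrite lee_fin box_volume_ge0.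
Qed.

Lemma lebesgue_outer0 : lebesgue_outer set0 = 0%E.
Proof.
apply/eqP; rewrite eq_le lebesgue_outer_ge0 andbT.
apply: ereal_inf_lbound; exists set0, (fun=> (0, 0)); split => //.
by rewrite esum_set0.
Qed.

Lemma le_lebesgue_outer : {homo lebesgue_outer : X Y / X `<=` Y >-> (X <= Y)%E}.
Proof.
move=> X Y XY; apply: ereal_inf_le_tmp => _ [D [B [YB ->]]].
by exists D, B; split => //; apply: subset_trans YB.
Qed.

Lemma lebesgue_outer_sigma_subadditive : sigma_subadditive lebesgue_outer.
Proof.
move=> A; have [[i ioo]|] := pselect (exists i, lebesgue_outer (A i) = +oo%E).
  by rewrite (eseries_pinfty _ _ ioo) ?leey// => k _;
    rewrite -ltNye (lt_le_trans _ (lebesgue_outer_ge0 _)).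
rewrite -forallNE => Aoo.
apply/lee_addgt0Pr => _/posnumP[e].
rewrite (le_trans _ (epsilon_trick _ _ _))//; last first.
  by move=> k; exact: lebesgue_outer_ge0.
pose P k (DB : set nat * (nat -> 'rV[R]_n * 'rV[R]_n)) :=
  A k `<=` \bigcup_(j in DB.1) box (DB.2 j) /\
  (\esum_(j in DB.1) (box_volume (DB.2 j))%:E <=
   lebesgue_outer (A k) + (e%:num / (2 ^ k.+1)%:R)%:E)%E.
have /choice[G PG] : forall k, exists DB, P k DB.
  move=> k; have e0 : 0 < e%:num / (2 ^ k.+1)%:R :> R by [].
  have fA : lebesgue_outer (A k) \is a fin_num.
    rewrite ge0_fin_numE ?lebesgue_outer_ge0// ltey; exact/eqP/Aoo.
  have [_ [D [B [AB ->]]] DBe] := lb_ereal_inf_adherent e0 fA.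
  by exists (D, B); split => //; exact/ltW.
have /card_esym/ppcard_eqP[f] := card_nat2.
pose J k : set nat := (G k).1.
pose D := f @^-1` [set p : nat * nat | J p.1 p.2].
pose v (p : nat * nat) : \bar R := (box_volume ((G p.1).2 p.2))%:E.
have v0 p : (0 <= v p)%E by rewrite lee_fin box_volume_ge0.
apply: (@le_trans _ _ (\esum_(k in D) v (f k))%E).
  apply: ereal_inf_lbound; exists D, (fun k => (G (f k).1).2 (f k).2).
  split => // x [k _ /(PG k).1 [j Jj xj]].
  by exists (f^-1%FUN (k, j)); rewrite /D /= invK ?inE.
rewrite (_ : (\esum_(k in D) v (f k) =
    \esum_(p in [set p : nat * nat | J p.1 p.2]) v p)%E); last first.
  symmetry; apply: (@reindex_esum _ _ _ D _ f); split => //.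
    by move=> i j _ _ /(congr1 f^-1%FUN); rewrite !funK ?inE.
  by move=> p Qp; exists (f^-1%FUN p); rewrite /D /= invK ?inE.
rewrite (_ : [set p | _] = [set: nat] `*`` J); last first.
  by apply/seteqP; split => p /=; [split|case].
rewrite -(esum_esum (a := fun i j => v (i, j)))// nneseries_esumT; last first.
  by move=> k; rewrite adde_ge0 ?lebesgue_outer_ge0.
by apply: le_esum => k _; exact: (PG k).2.
Qed.

HB.instance Definition _ := isOuterMeasure.Build R 'rV[R]_n lebesgue_outer
  lebesgue_outer0 lebesgue_outer_ge0 le_lebesgue_outer
  lebesgue_outer_sigma_subadditive.

End LebesgueMeasure.

(* 'rV[R]_n with the sigma-algebra of all Lebesgue measurable sets (complete,
   not merely the Borel sets), obtained by Caratheodory's construction. *)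
Definition lebesgue_rV (R : realType) (n : nat) :=
  caratheodory_type (@lebesgue_outer R n : {outer_measure set _ -> \bar R}).

Definition lebesgue_measure_rV (R : realType) (n : nat) :
    {measure set (lebesgue_rV R n) -> \bar R} :=
  (@lebesgue_outer R n : {outer_measure set _ -> \bar R}).

Definition lebesgue_measurable_fun (R : realType) (n : nat)
    (f : 'rV[R]_n -> R) :=
  measurable_fun setT (f : lebesgue_rV R n -> R).

(* The analogue on R^n of [locally_integrable], which the library only has for
   functions of one real variable. *)
Definition locally_integrable_rV (R : realType) (n : nat) (f : 'rV[R]_n -> R) :=
  lebesgue_measurable_fun f /\
  forall K : set 'rV[R]_n, compact K ->
    (\int[lebesgue_measure_rV R n]_(x in K) `|f x|%:E < +oo)%E.

(* Every component of a multi-index of order m is at most m, so the multi-indices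
   of order m are the alpha in the finite type {ffun 'I_n -> 'I_m.+1} such that
   multi_order alpha = m; the family a is only used at these. *)
Definition multi_order (n m : nat) (alpha : {ffun 'I_n -> 'I_m.+1}) : nat :=
  (\sum_(i < n) alpha i)%N.

Section PartialDerivatives.
Context {R : realType} {n : nat}.
Implicit Types f phi : 'rV[R]_n -> R.

Definition partial (i : 'I_n) f : 'rV[R]_n -> R :=
  fun x => 'D_(delta_mx ord0 i) f x.

(* d_0^(alpha 0) (d_1^(alpha 1) (... f)); the order is irrelevant for the smooth
   functions to which this is applied. *)
Definition multi_partial (m : nat) (alpha : {ffun 'I_n -> 'I_m.+1}) f :
    'rV[R]_n -> R :=
  foldr (fun i h => iter (alpha i) (partial i) h) f (enum 'I_n).

Definition smooth f :=
  forall s : seq 'I_n, let h := foldr partial f s in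
    continuous h /\ forall i x, derivable h x (delta_mx ord0 i).

Definition test_function phi :=
  smooth phi /\ compact (closure [set x | phi x != 0]).

End PartialDerivatives.

Definition Caratheodory_function (R : realType) (n : nat)
    (a : 'rV[R]_n -> R -> R) :=
  (forall z, lebesgue_measurable_fun (a ^~ z)) /\
  \forall x \ae lebesgue_measure_rV R n, continuous (a x).

Definition global_weak_solution (R : realType) (n m : nat)
    (a : {ffun 'I_n -> 'I_m.+1} -> 'rV[R]_n -> R -> R) (g : R -> R)
    (u : 'rV[R]_n -> R) :=
  [/\ locally_integrable_rV u,
      locally_integrable_rV (fun x => g `|u x|) &
      forall phi : 'rV[R]_n -> R,
        test_function phi -> (forall x, 0 <= phi x) ->
        (\int[lebesgue_measure_rV R n]_x
           (\sum_(alpha | multi_order alpha == m)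
              (-1) ^+ m * a alpha x (u x) * multi_partial alpha phi x)%:E >=
         \int[lebesgue_measure_rV R n]_x (g `|u x| * phi x)%:E)%E].

(* Main.v *)
Require Import Defs.
From mathcomp Require Import all_boot all_order all_algebra.
From mathcomp Require Import all_classical all_reals all_analysis.
From mathcomp Require Import measurable_realfun ring lra.

Set Implicit Arguments.
Unset Strict Implicit.
Unset Printing Implicit Defensive.

Import Order.TTheory GRing.Theory Num.Theory.
Import numFieldNormedType.Exports.

Local Open Scope classical_set_scope.
Local Open Scope ring_scope.

(** The argument is a Keller-Osserman iteration on cubes.  Write Q_r for the cube
[-r, r]^n, E(r) for the integral of |u| over Q_r, G(r) for that of g(|u|), and
V(r) for the volume of Q_r.

Testing the inequality with a smooth cutoff of Q_r supported in Q_(r + d), whose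
derivatives of order m are at most C d^-m with C independent of r and d, and
using |a_alpha(x, u)| <= A |u|, gives the capacity estimate
  d^m G(r) <= C E(r + d)                           (weak_solution_capacity).
Conversely, Jensen's inequality for the convex function g shows that
E(r) >= t V(r) forces G(r) >= g(t) V(r)            (jensen_support_line).

Suppose that the mean of |u| over Q_r exceeds 2^(n+1) for some large r.
Combining the two estimates, the mean of |u| (with respect to the volume of
Q_2r) passes from zeta to 2 zeta when the radius grows by a constant times
(zeta / g(zeta))^(1/m).  Along zeta = 2, 4, 8, ... these increments have a finite
sum, because the integral of g^(-1/m) zeta^(1/m - 1) converges
(dyadic_sum_bounded).  If r exceeds a multiple of this sum, all the radii stay
below 2r.  Hence the energy would be infinite in Q_2r, although u is
locally integrable (mean_growth_bounded).

So E(r) = O(r^n), and the capacity estimate with d = r gives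
G(r) <= C r^-m E(2r) = O(r^(n - m)), which is bounded since m >= n.  As g is
positive and at least linear at infinity, |u| <= e + c_e g(|u|) for every e > 0,
so that E(2r) <= e V(2r) + c_e G(2r); inserted in the same estimate this yields
G(r) = O(e) + O(1/r), whence G = 0 (energy_vanishes), g(|u|) = 0 and u = 0 almost
everywhere.

The cutoff is a product of one-dimensional cutoffs built on the flat function
exp(-1/t), and the cubes are shown measurable directly from Caratheodory's
criterion. *)

(** * A smooth step function on the line *)

(** This is the recursion on derivatives by which all closure properties below
are proved; f is smooth when it holds for every n, and no Leibniz or Faa di
Bruno formula is then ever written down. *)
Fixpoint nderivable (R : realType) (n : nat) (f : R -> R) : Prop :=
  if n is k.+1 then (forall x, derivable f x 1) /\ nderivable k (derive1 f) else True.

Section NDerivable.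
Context {R : realType}.
Implicit Types (f g : R -> R) (n : nat).

Lemma is_derive1 f f' : (forall x : R, is_derive x 1 f (f' x)) ->
  (forall x, derivable f x 1) /\ derive1 f = f'.
Proof.
move=> h; split=> [x|]; first by have [] := h x.
by apply/funext => x; rewrite derive1E; have [_ ->] := h x.
Qed.

Lemma nderivableS n f : nderivable n.+1 f -> nderivable n f.
Proof.
elim: n f => [//|n IH] f /= [df [ddf h]]; split => //.
by apply: IH; split.
Qed.

Lemma nderivable_is_derive n f f' :
  (forall x : R, is_derive x 1 f (f' x)) -> nderivable n f' -> nderivable n.+1 f.
Proof. by move=> /is_derive1[df dfE] ?; split => //; rewrite dfE. Qed.

Lemma nderivable_cst n (c : R) : nderivable n (fun=> c).
Proof.
elim: n c => [//|n IH] c; apply: (@nderivable_is_derive _ _ (fun=> 0)) => // x.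
Qed.

Lemma nderivableD n f g : nderivable n f -> nderivable n g ->
  nderivable n (fun x => f x + g x).
Proof.
elim: n f g => [//|n IH] f g [df hf] [dg hg].
apply: (@nderivable_is_derive _ _ (fun x => derive1 f x + derive1 g x)); last exact: IH.
by move=> x; apply: is_deriveD; rewrite derive1E; exact/derivableP.
Qed.

Lemma nderivableM n f g : nderivable n f -> nderivable n g ->
  nderivable n (fun x => f x * g x).
Proof.
elim: n f g => [//|n IH] f g Hf Hg.
move: (Hf) (Hg) => [df hf] [dg hg].
have dfg x : is_derive x (1 : R) (fun x => f x * g x)
    (f x * derive1 g x + g x * derive1 f x).
  by apply: is_deriveM; rewrite derive1E; exact/derivableP.
apply: (nderivable_is_derive dfg).
by apply: nderivableD; apply: IH => //; exact: nderivableS.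
Qed.

Lemma nderivableV n f : (forall x, f x != 0) -> nderivable n f ->
  nderivable n (fun x => (f x)^-1).
Proof.
move=> f0; elim: n => [//|n IH] Hf; have [df hf] := Hf.
apply: (@nderivable_is_derive _ _
  (fun x => (-1 * ((f x)^-1 * (f x)^-1)) * derive1 f x)).
  move=> x; have -> : -1 * ((f x)^-1 * (f x)^-1) = - (f x) ^- 2.
    by rewrite mulN1r -exprVn.
  by apply: is_deriveV => //; rewrite derive1E; exact/derivableP.
apply: nderivableM => //; apply: nderivableM; first exact: nderivable_cst.
by apply: nderivableM; apply: IH; exact: nderivableS.
Qed.

Lemma is_derive_affine f (a b x d : R) : is_derive (a * x + b) 1 f d ->
  is_derive x 1 (fun x => f (a * x + b)) (d * a).
Proof.
move=> fd; apply: (@is_derive1_comp _ f (fun x => a * x + b)) => //.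
have dl : is_derive x 1 ((a \*: (id : R -> R)) + cst b) (a *: 1 + 0).
  by apply: is_deriveD.
by rewrite addr0 /GRing.scale/= mulr1 in dl.
Qed.

Lemma nderivable_affine n f (a b : R) : nderivable n f ->
  nderivable n (fun x => f (a * x + b)).
Proof.
elim: n f => [//|n IH] f [df hf].
have df' x : is_derive x (1 : R) (fun x => f (a * x + b)) (derive1 f (a * x + b) * a).
  by apply: is_derive_affine; rewrite derive1E; exact/derivableP.
apply: (nderivable_is_derive df').
by apply: nderivableM; [exact: IH|exact: nderivable_cst].
Qed.

Lemma nderivable_derive1n f : (forall n, nderivable n f) ->
  forall k (x : R), is_derive x 1 (derive1n k f) (derive1n k.+1 f x).
Proof.
move=> hf k x; rewrite derive1nS derive1E; apply/derivableP.
have : forall n, nderivable n (derive1n k f).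
  elim: k => [|k IH] n; first exact: hf.
  by rewrite derive1nS; have [] := IH n.+1.
by move=> /(_ 1)[].
Qed.

(** Termwise, s ^ k / k! is a term of the exponential series. *)
Lemma poly_le_expR (p : {poly R}) :
  exists2 C, 0 <= C & forall s, 0 <= s -> `|p.[s]| <= C * expR s.
Proof.
exists (\sum_(i < size p) `|p`_i| * i`!%:R).
  by apply: sumr_ge0 => i _; rewrite mulr_ge0.
move=> s s0; rewrite horner_coef mulr_suml (le_trans (ler_norm_sum _ _ _))//.
apply: ler_sum => i _; rewrite normrM -mulrA ler_wpM2l// ger0_norm ?exprn_ge0//.
case: (nat_of_ord i) => [|k]; first by rewrite expr0 mul1r -expR0 ler_expR.
rewrite mulrC -ler_pdivrMr ?ltr0n ?fact_gt0//.
by rewrite (le_trans _ (expR_ge1Dxn k s0))// lerDr.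
Qed.

Lemma is_derive0_quadratic f (C : R) : (forall t, `|f t| <= C * t ^+ 2) ->
  is_derive (0 : R) 1 f 0.
Proof.
move=> fC.
have f0 : f 0 = 0.
  apply/eqP; rewrite -normr_eq0 eq_le normr_ge0 andbT.
  by rewrite (le_trans (fC 0))// expr0n mulr0.
have C0 : 0 <= C.
  by have := le_trans (normr_ge0 _) (fC 1); rewrite expr1n mulr1.
have H : (fun h : R => h^-1 *: ((f \o shift 0) (h *: (1:R)) - f 0)) @ 0^' --> (0 : R).
  apply/cvgrPdist_le => e e0; near=> h.
  rewrite sub0r normrN /= f0 subr0 addr0 /GRing.scale/= mulr1 normrM normfV.
  have h0 : h != 0 by near: h; exact: nbhs_dnbhs_neq.
  rewrite ler_pdivrMl ?normr_gt0// (le_trans (fC h))// -real_normK ?num_real//.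
  rewrite expr2 mulrA mulrC ler_wpM2l//.
  have hC : `|h| <= e / (C + 1).
    near: h; apply: dnbhs0_le.
    by rewrite divr_gt0// ltr_wpDl.
  rewrite (le_trans (ler_wpM2l C0 hC))// mulrCA ger_pMr// ler_pdivrMr ?mul1r ?lerDl//.
  by rewrite ltr_wpDl.
apply: DeriveDef; first by apply/cvg_ex; exists 0.
exact/cvg_lim.
Unshelve. all: by end_near. Qed.

(** The functions p(1/t) exp(-1/t), extended by 0 to t <= 0, form a family stable
under derivation, which is what makes exp(-1/t) smooth at the origin. *)
Definition flat (p : {poly R}) (t : R) : R :=
  if 0 < t then p.[t^-1] * expR (- t^-1) else 0.

(** Away from 0 this is the chain rule.  At 0, p(s) s ^ 2 = O(exp s) at infinity
gives |flat p t| <= C t ^ 2, hence the derivative 0. *)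
Lemma is_derive_flat (p : {poly R}) (t : R) :
  is_derive t 1 (flat p) (flat ('X^2 * (p - p^`())) t).
Proof.
have [t0|t0|->] := ltrgtP t 0.
- rewrite {2}/flat ltNge (ltW t0)/=.
  apply: (@near_eq_is_derive _ _ _ (cst 0)).
  near=> s; rewrite /flat ifF//; apply/negbTE; rewrite -leNgt.
  by apply: ltW; near: s; exact: lt_nbhsl.
- rewrite {2}/flat t0.
  have dV : is_derive t 1 (fun s : R => s^-1) (- t^-2).
    apply: DeriveDef; first by apply: derivableV => //; rewrite gt_eqF.
    by rewrite (@deriveV _ _ id) ?gt_eqF// derive_id /GRing.scale/= mulr1.
  have dp : is_derive t 1 (fun s : R => p.[s^-1]) (p^`().[t^-1] * (- t^-2)).
    have /derivableP := @derivable_horner _ p t^-1.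
    by rewrite -derive1E -derivE => /is_derive1_comp; apply.
  have de : is_derive t 1 (fun s : R => expR (- s^-1)) (expR (- t^-1) * (- - t^-2)).
    apply: (@is_derive1_comp _ expR (fun s => - s^-1)).
  have dflat := is_deriveM dp de.
  apply: (near_eq_is_derive (_ : \near t, _ t = flat p t)) (is_derive_eq dflat _).
    by near=> s; rewrite /flat ifT//; near: s; exact: lt_nbhsr.
  rewrite /GRing.scale/= hornerM hornerXn hornerD hornerN -exprVn; ring.
- rewrite {2}/flat ltxx.
  have [C C0 pC] := poly_le_expR ('X^2 * p).
  apply: (@is_derive0_quadratic _ C) => t'; rewrite /flat.
  case: ifPn => [t0|_]; last first.
    by rewrite normr0 mulr_ge0// sqr_ge0.
  have := pC t'^-1; rewrite invr_ge0 (ltW t0) => /(_ isT).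
  rewrite hornerM hornerXn !normrM !normfV expRN normfV.
  rewrite (gtr0_norm t0) (gtr0_norm (expR_gt0 _)) ler_pdivrMr ?expR_gt0//.
  by rewrite -invfM mulrC ler_pdivrMr ?mulr_gt0// mulrAC.
Unshelve. all: by end_near. Qed.

Lemma nderivable_flat n p : nderivable n (flat p).
Proof.
elim: n p => [//|n IH] p; apply: nderivable_is_derive (IH _) => x.
exact: is_derive_flat.
Qed.

Definition smooth_step (t : R) : R := flat 1 t / (flat 1 t + flat 1 (1 - t)).

Lemma flat_ge0 t : 0 <= flat 1 t.
Proof. by rewrite /flat; case: ifP => // _; rewrite hornerC mul1r expR_ge0. Qed.

Lemma flat_gt0 t : 0 < t -> 0 < flat 1 t.
Proof. by rewrite /flat => ->; rewrite hornerC mul1r expR_gt0. Qed.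

Lemma flat_eq0 p t : t <= 0 -> flat p t = 0.
Proof. by rewrite /flat ltNge => ->. Qed.

Lemma smooth_step_denom_gt0 t : 0 < flat 1 t + flat 1 (1 - t).
Proof.
have [t0|t0] := ltP 0 t; first by rewrite ltr_wpDr ?flat_ge0 ?flat_gt0.
by rewrite ltr_wpDl ?flat_ge0 ?flat_gt0// subr_gt0 (le_lt_trans t0).
Qed.

Lemma smooth_step_ge0 t : 0 <= smooth_step t.
Proof. by rewrite divr_ge0 ?flat_ge0// ltW ?smooth_step_denom_gt0. Qed.

Lemma smooth_step_le1 t : smooth_step t <= 1.
Proof. by rewrite ler_pdivrMr ?smooth_step_denom_gt0// mul1r lerDl flat_ge0. Qed.

Lemma smooth_step_eq0 t : t <= 0 -> smooth_step t = 0.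
Proof. by move=> t0; rewrite /smooth_step flat_eq0// mul0r. Qed.

Lemma smooth_step_eq1 t : 1 <= t -> smooth_step t = 1.
Proof.
move=> t1; have := smooth_step_denom_gt0 t.
rewrite /smooth_step (@flat_eq0 _ (1 - t)) ?subr_le0// addr0 => /lt0r_neq0 ?.
exact: divff.
Qed.

Lemma nderivable_smooth_step n : nderivable n smooth_step.
Proof.
apply: nderivableM; first exact: nderivable_flat.
apply: nderivableV; first by move=> x; rewrite gt_eqF// smooth_step_denom_gt0.
apply: nderivableD; first exact: nderivable_flat.
have -> : (fun t : R => flat 1 (1 - t)) = (fun t => flat 1 (-1 * t + 1)).
  by apply/funext => t; rewrite mulN1r addrC.
by apply: nderivable_affine; exact: nderivable_flat.
Qed.

Lemma derive1n_locally_cst (U : set R) f c : open U -> (forall x, U x -> f x = c) ->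
  forall k x, U x -> derive1n k.+1 f x = 0.
Proof.
move=> oU fc; suff H : forall (h : R -> R) d, (forall x, U x -> h x = d) ->
    forall x, U x -> derive1 h x = 0.
  by elim=> [|k IH] x Ux; rewrite derive1nS; [exact: (H f c)|exact: (H _ 0)].
move=> h d hd x Ux; rewrite derive1E (@near_eq_derive _ _ _ h (cst d)) ?derive_cst//.
by near=> y; apply: hd; near: y; exact: open_nbhs_nbhs.
Unshelve. all: by end_near. Qed.

(** The step is locally constant outside [0, 1], so its derivatives only have to
be bounded on this compact interval. *)
Lemma smooth_step_derive1n_bounded k :
  exists2 M, 0 <= M & forall t, `|derive1n k smooth_step t| <= M.
Proof.
case: k => [|k].
  exists 1 => // t; rewrite derive1n0 ger0_norm ?smooth_step_ge0//.
  exact: smooth_step_le1.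
have dS := nderivable_derive1n nderivable_smooth_step k.+1.
have cS : {within `[0, 1]%classic, continuous (derive1n k.+1 smooth_step)}.
  apply: derivable_within_continuous => x _.
  by have [] := dS x.
have cN : {within `[0, 1]%classic,
    continuous (fun x => `|derive1n k.+1 smooth_step x|)}.
  by move=> x; apply: continuous_comp; [exact: cS|exact: norm_continuous].
have [c _ cmax] := EVT_max ler01 cN.
exists `|derive1n k.+1 smooth_step c| => // t.
have [t0|t0] := ltP t 0.
  have S0 (x : R) : x < 0 -> smooth_step x = 0 by move=> /ltW; exact: smooth_step_eq0.
  by rewrite (derive1n_locally_cst (@open_lt _ 0) S0)// normr0.
have [t1|t1] := ltP 1 t; last by apply: cmax; rewrite in_itv/= t0.
have S1 (x : R) : 1 < x -> smooth_step x = 1 by move=> /ltW; exact: smooth_step_eq1.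
by rewrite (derive1n_locally_cst (@open_gt _ 1) S1)// normr0.
Qed.

End NDerivable.

(** * Smooth cutoffs of cubes *)

Section TensorPowers.
Context {R : realType} {n : nat}.
Variable psi : nat -> R -> R.
Hypothesis dpsi : forall k (x : R), is_derive x 1 (psi k) (psi k.+1 x).
Implicit Types k : 'I_n -> nat.

(** In the application psi j is the j-th derivative of psi 0; a multi-exponent k
then indexes every mixed partial derivative of the tensor power of psi 0, so
that partial derivatives only shift k. *)
Definition tensor k (x : 'rV[R]_n) : R := \prod_i psi (k i) (x ord0 i).

Let psi_continuous (k : nat) : continuous (psi k).
Proof.
move=> x; apply/differentiable_continuous/derivable1_diffP.
by have [] := dpsi k x.
Qed.

Lemma tensor_continuous k : continuous (tensor k).
Proof.
rewrite /tensor; elim: (index_enum _) => [|i s IH] x.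
  under eq_fun do rewrite big_nil.
  exact: (@cst_continuous _ _ (1 : R)).
under eq_fun do rewrite big_cons.
apply: (@continuousM _ _ (fun x : 'rV[R]_n => psi (k i) (x ord0 i))); last exact: IH.
apply: (@continuous_comp _ _ _ (fun x : 'rV[R]_n => x ord0 i)).
  exact: coord_continuous.
exact: psi_continuous.
Qed.

(** Moving x along the j-th coordinate changes a single factor of the product, so
the difference quotient is that of one function of one variable. *)
Lemma is_derive_tensor k j (x : 'rV[R]_n) :
  is_derive x (delta_mx ord0 j) (tensor k)
    (tensor (fun i => k i + (i == j))%N x).
Proof.
pose c := \prod_(i | i != j) psi (k i) (x ord0 i).
have tensorE (h : R) : tensor k (h *: delta_mx ord0 j + x) =
    psi (k j) (h *: 1 + x ord0 j) * c.
  rewrite /tensor (bigD1 j)//=; congr (_ * _); first by rewrite !mxE !eqxx.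
  apply: eq_bigr => i ij.
  by rewrite !mxE eqxx (negbTE ij) /= mulr0 add0r.
have -> : tensor (fun i => k i + (i == j))%N x = psi (k j).+1 (x ord0 j) * c.
  rewrite /tensor (bigD1 j)//= eqxx addn1; congr (_ * _).
  by apply: eq_bigr => i /negbTE ->; rewrite addn0.
have tensor0 : tensor k x = psi (k j) (x ord0 j) * c by rewrite /tensor (bigD1 j).
have [dj djE] := dpsi (k j) (x ord0 j).
have H : (fun h : R => h^-1 *:
    ((tensor k \o shift x) (h *: delta_mx ord0 j) - tensor k x)) @ 0^' -->
    psi (k j).+1 (x ord0 j) * c.
  rewrite (_ : (fun h : R => _) = (fun h => (h^-1 *:
      ((psi (k j) \o shift (x ord0 j)) (h *: 1) - psi (k j) (x ord0 j))) * c));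
      last first.
    by apply/funext => h /=; rewrite tensorE tensor0 -mulrBl -scalerAl.
  apply: cvgMl; rewrite -djE; exact: dj.
apply: DeriveDef; first by apply/cvg_ex; eexists; exact: H.
exact/cvg_lim.
Qed.

Lemma partial_tensor k j : partial j (tensor k) = tensor (fun i => k i + (i == j))%N.
Proof. by apply/funext => x; have [_] := is_derive_tensor k j x. Qed.

Lemma iter_partial_tensor k j p :
  iter p (partial j) (tensor k) = tensor (fun i => k i + p * (i == j))%N.
Proof.
elim: p => [|p IH]; first by congr tensor; apply/funext => i; rewrite mul0n addn0.
rewrite iterS IH partial_tensor; congr tensor; apply/funext => i.
by rewrite mulSn addnA [in RHS]addnAC.
Qed.

Lemma foldr_partial_tensor k (s : seq 'I_n) :
  foldr partial (tensor k) s = tensor (fun i => k i + count_mem i s)%N.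
Proof.
elim: s => [|j s IH] /=; first by congr tensor; apply/funext => i; rewrite addn0.
rewrite IH partial_tensor; congr tensor; apply/funext => i.
by rewrite eq_sym addnA addnAC.
Qed.

Lemma smooth_tensor k : smooth (tensor k).
Proof.
move=> s h; rewrite /h foldr_partial_tensor; split; first exact: tensor_continuous.
by move=> i x; case: (is_derive_tensor (fun i => k i + count_mem i s)%N i x).
Qed.

Lemma multi_partial_tensor m (alpha : {ffun 'I_n -> 'I_m.+1}) :
  multi_partial alpha (tensor (fun=> 0%N)) = tensor (fun i => alpha i).
Proof.
rewrite /multi_partial.
have -> (s : seq 'I_n) :
    foldr (fun i h => iter (alpha i) (partial i) h) (tensor (fun=> 0%N)) s =
    tensor (fun i => alpha i * count_mem i s)%N.
  elim: s => [|j s IH] /=; first by congr tensor; apply/funext => i; rewrite muln0.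
  rewrite IH iter_partial_tensor; congr tensor; apply/funext => i.
  by rewrite mulnDr addnC eq_sym; case: eqP => [->|]//; rewrite !muln0.
congr tensor; apply/funext => i.
by rewrite count_uniq_mem ?enum_uniq// mem_enum muln1.
Qed.

End TensorPowers.

Definition cube (R : realType) (n : nat) (r : R) : set 'rV[R]_n :=
  box (const_mx (- r), const_mx r).

Section Cubes.
Context {R : realType} {n : nat}.

Lemma cubeP (r : R) (x : 'rV[R]_n) : cube r x <-> forall i, `|x ord0 i| <= r.
Proof.
by split=> h i; move: (h i); rewrite /= !mxE ler_norml.
Qed.

Lemma compact_cube (r : R) : compact (cube r : set 'rV[R]_n).
Proof.
rewrite (_ : cube r = [set x : 'rV[R]_n | forall i, `[- r, r]%classic (x ord0 i)]).
  apply: (@rV_compact _ _ (fun=> `[- r, r]%classic)) => i.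
  exact: segment_compact.
by apply/seteqP; split => x h i; move: (h i); rewrite /= !mxE in_itv.
Qed.

Lemma closed_cube (r : R) : closed (cube r : set 'rV[R]_n).
Proof. apply: compact_closed; [exact: norm_hausdorff|exact: compact_cube]. Qed.

Lemma sub_cube (r s : R) : r <= s -> cube r `<=` (cube s : set 'rV[R]_n).
Proof. by move=> rs x /cubeP xr; apply/cubeP => i; exact: le_trans rs. Qed.

End Cubes.

Section Cutoff.
Context {R : realType}.
Variables (r d : R).
Hypotheses (r0 : 0 <= r) (d0 : 0 < d).
Local Notation S k := (derive1n k (@smooth_step R)).
Local Notation b := (r / d + 1).

(** The k-th derivative of S((r + d + t) / d) + S((r + d - t) / d) - 1, where S is
the smooth step.  At least one of the two steps equals 1 at every t; adding
them (rather than multiplying them) keeps the derivatives explicit. *)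
Definition cutoff1 (k : nat) (t : R) : R :=
  d^-1 ^+ k * S k (d^-1 * t + b) + (- d^-1) ^+ k * S k (- d^-1 * t + b) - (k == 0%N)%:R.

Lemma is_derive_cutoff1 k (t : R) : is_derive t 1 (cutoff1 k) (cutoff1 k.+1 t).
Proof.
have dS := nderivable_derive1n (@nderivable_smooth_step R).
have D (e : R) : is_derive t 1 (fun t => e ^+ k * S k (e * t + b))
    (e ^+ k.+1 * S k.+1 (e * t + b)).
  have -> : e ^+ k.+1 * S k.+1 (e * t + b) = e ^+ k * (S k.+1 (e * t + b) * e).
    by rewrite exprSr -mulrA (mulrC e).
  have H := is_deriveZ (e ^+ k) (is_derive_affine (dS k (e * t + b))).
  exact H.
have H := is_deriveB (is_deriveD (D d^-1) (D (- d^-1)))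
  (is_derive_cst ((k == 0%N)%:R : R) t 1).
exact H.
Qed.

Let arg_ge1 (t : R) : - r <= t -> 1 <= d^-1 * t + b.
Proof.
move=> rt; rewrite [r / d]mulrC addrA -mulrDr lerDr mulr_ge0 ?invr_ge0 ?(ltW d0)//.
by rewrite -lerBlDr sub0r.
Qed.

Let arg_lt0 (t : R) : t < - (r + d) -> d^-1 * t + b < 0.
Proof.
move=> rt; have -> : b = d^-1 * (r + d) by rewrite mulrDr mulVf ?gt_eqF// mulrC.
by rewrite -mulrDr pmulr_rlt0 ?invr_gt0// -ltrBrDr sub0r.
Qed.

Let NarE (t : R) : - d^-1 * t = d^-1 * (- t). Proof. by rewrite mulNr mulrN. Qed.

Let S_gt1 k t : 1 < t -> S k t = (k == 0%N)%:R.
Proof.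
case: k => [|k] t1; first by rewrite derive1n0 smooth_step_eq1// ltW.
have S1 (x : R) : 1 < x -> smooth_step x = 1 by move=> /ltW; exact: smooth_step_eq1.
by rewrite (derive1n_locally_cst (@open_gt _ 1) S1).
Qed.

Let S_lt0 k t : t < 0 -> S k t = 0.
Proof.
case: k => [|k] t0; first by rewrite derive1n0 smooth_step_eq0// ltW.
have S0 (x : R) : x < 0 -> smooth_step x = 0 by move=> /ltW; exact: smooth_step_eq0.
by rewrite (derive1n_locally_cst (@open_lt _ 0) S0).
Qed.

Lemma cutoff1_out k t : r + d < `|t| -> cutoff1 k t = 0.
Proof.
have arg_gt1 (s : R) : r + d < s -> 1 < d^-1 * s + b.
  move=> rs; rewrite [r / d]mulrC addrA -mulrDr ltrDr mulr_gt0 ?invr_gt0//.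
  by rewrite ltr_wpDr// (le_lt_trans _ rs)// addr_ge0// ltW.
have e1 (e : R) : e ^+ k * (k == 0%N)%:R = (k == 0%N)%:R.
  by case: k => [|k]; rewrite ?expr0 ?mulr1 ?mulr0.
rewrite /cutoff1; have [t0|t0] := ger0P t.
  move=> rt; rewrite NarE (S_gt1 _ (arg_gt1 _ rt)) S_lt0.
    by rewrite e1 mulr0 addr0 subrr.
  by apply: arg_lt0; rewrite ltrN2.
move=> rt; rewrite NarE (S_gt1 _ (arg_gt1 _ rt)) S_lt0.
  by rewrite e1 mulr0 add0r subrr.
by apply: arg_lt0; rewrite -[t]opprK ltrN2.
Qed.

Lemma cutoff1_in t : `|t| <= r -> cutoff1 0 t = 1.
Proof.
rewrite ler_norml => /andP[rt tr]; rewrite /cutoff1 NarE derive1n0 !expr0 !mul1r.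
by rewrite !smooth_step_eq1 ?addrK// arg_ge1// lerN2.
Qed.

Lemma cutoff1_0_bounds t : 0 <= cutoff1 0 t <= 1.
Proof.
rewrite /cutoff1 NarE derive1n0 !expr0 !mul1r.
have [t0|t0] := leP 0 t.
  rewrite (smooth_step_eq1 (arg_ge1 _)); last by rewrite (le_trans _ t0)// oppr_le0.
  by rewrite [1 + _]addrC addrK smooth_step_ge0 smooth_step_le1.
rewrite (smooth_step_eq1 (arg_ge1 (t := - t) _)); last first.
  by rewrite lerN2 (le_trans (ltW t0)).
by rewrite addrK smooth_step_ge0 smooth_step_le1.
Qed.

Lemma cutoff1_bound k M : (forall t, `|S k t| <= M) ->
  forall t, `|cutoff1 k t| <= (2 * M + 1) * d^-1 ^+ k.
Proof.
move=> SM t; have dk : 0 < d^-1 ^+ k by rewrite exprn_gt0 ?invr_gt0.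
have M0 : 0 <= M by exact: le_trans (SM 0).
case: k SM dk => [|k] SM dk.
  have /andP[c0 c1] := cutoff1_0_bounds t.
  by rewrite ger0_norm// (le_trans c1)// expr0 mulr1 lerDr mulr_ge0.
rewrite /cutoff1 subr0 (le_trans (ler_normD _ _))//.
rewrite !normrM !normrX normrN (gtr0_norm (_ : 0 < d^-1)) ?invr_gt0// -mulrDr mulrC.
rewrite ler_pM2r// mulr2n mulrDl mul1r.
by rewrite (le_trans (lerD (SM _) (SM _)))// lerDl.
Qed.

End Cutoff.

(** A tensor power of one-dimensional cutoffs: the factor d ^- m comes from the
chain rule, each derivative costing d ^-1, and C depends on m and n only.  This
uniformity in r and d is what the whole argument rests on. *)
Lemma cutoff_exists (R : realType) (n m : nat) : exists2 C : R, 0 < C &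
  forall r d : R, 0 <= r -> 0 < d -> exists phi : 'rV[R]_n -> R,
    [/\ test_function phi,
        forall x, 0 <= phi x,
        forall x, cube r x -> phi x = 1 &
        forall alpha : {ffun 'I_n -> 'I_m.+1}, multi_order alpha = m ->
        forall x, `|multi_partial alpha phi x| <= C * d ^- m /\
          (~ cube (r + d) x -> multi_partial alpha phi x = 0)].
Proof.
have /choice[M hM] : forall k : nat, exists M, 0 <= M /\
    forall t : R, `|derive1n k smooth_step t| <= M.
  by move=> k; have [M ? ?] := @smooth_step_derive1n_bounded R k; exists M.
pose B := \sum_(k < m.+1) (2 * M k + 1).
have MB k : (k <= m)%N -> 2 * M k + 1 <= B.
  move=> km; rewrite /B (bigD1 (inord k))//= inordK// lerDl sumr_ge0// => i _.
  by rewrite addr_ge0// mulr_ge0//; have [] := hM i.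
have B1 : 0 < B.
  by rewrite (lt_le_trans _ (MB 0%N isT))// ltr_wpDl// mulr_ge0//; have [] := hM 0%N.
exists (B ^+ n); first by rewrite exprn_gt0.
move=> r d r0 d0; pose psi := cutoff1 r d.
have dpsi k (x : R) : is_derive x 1 (psi k) (psi k.+1 x) by exact: is_derive_cutoff1.
pose phi : 'rV[R]_n -> R := tensor psi (fun=> 0%N).
have out k x : ~ cube (r + d) x -> @tensor _ n psi k x = 0.
  move=> /cubeP/existsNP[i /negP]; rewrite -ltNge => ri.
  by rewrite /tensor (bigD1 i)//= /psi cutoff1_out// mul0r.
exists phi; split.
- split; first exact: smooth_tensor.
  apply: (@subclosed_compact _ _ (cube (r + d))); first exact: closed_closure.
    exact: compact_cube.
  rewrite closureE => x; apply; split; first exact: closed_cube.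
  by move=> y /= /eqP; apply: contra_notP; exact: out.
- move=> x; apply: prodr_ge0 => i _.
  by have /andP[] := cutoff1_0_bounds r0 d0 (x ord0 i).
- by move=> x /cubeP xr; apply: big1 => i _; rewrite /psi cutoff1_in.
move=> alpha am x; rewrite multi_partial_tensor//; split; last exact: out.
rewrite /tensor normr_prod (@le_trans _ _ (\prod_(i < n) (B * d^-1 ^+ alpha i)))//.
  apply: ler_prod => i _; rewrite normr_ge0/=.
  apply: (le_trans (cutoff1_bound r0 d0 (hM (alpha i)).2 _)).
  by rewrite ler_wpM2r ?exprn_ge0 ?invr_ge0 ?(ltW d0)// MB// -ltnS.
by rewrite big_split/= prodr_const card_ord prodrXr -exprVn -[X in _ <= _ * _ ^+ X]am.
Qed.

(** * Monotonicity of the integral *)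

Section IntegralMonotone.
Local Open Scope ereal_scope.
Context d (T : measurableType d) (R : realType).
Variable mu : {measure set T -> \bar R}.
Implicit Types f h : T -> \bar R.

(** The integral of a nonnegative function is a supremum over the simple functions
below it, and is thus monotone without any measurability: this serves for the
integrand of the differential operator, where a(x, u(x)) is only known through
an almost everywhere bound. *)
Lemma le_integral_nonmeasurable D f h :
  (forall x, D x -> 0 <= h x) -> (forall x, D x -> f x <= h x) ->
  \int[mu]_(x in D) f x <= \int[mu]_(x in D) h x.
Proof.
move=> h0 fh; rewrite integralE.
have fp0 x : D x -> 0 <= f^\+ x by [].
apply: (@le_trans _ _ (\int[mu]_(x in D) f^\+ x)).
  by rewrite geeDl// oppe_le0 integral_ge0.
rewrite !ge0_integralE//; apply: ereal_sup_le => _ [k kf <-].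
exists k => // x.
apply: (le_trans (kf x)); apply: lee_restrict => y Dy.
by rewrite funeposE ge_max fh//= h0.
Qed.

(** On an exceptional null set N the bound h is replaced by +oo, which leaves its
integral unchanged. *)
Lemma ae_le_integral_nonmeasurable f h : measurable_fun setT h ->
  (forall x, 0 <= h x) -> (\forall x \ae mu, f x <= h x) ->
  \int[mu]_x f x <= \int[mu]_x h x.
Proof.
move=> mh h0 [N [mN N0 fhN]].
have m1 : measurable_fun setT (fun x => (\1_N x)%:E : \bar R).
  exact/measurable_EFinP/measurable_indic.
have -> : \int[mu]_x h x = \int[mu]_x (h x + +oo * (\1_N x)%:E).
  rewrite ge0_integralD//; last exact: measurable_funeM.
  rewrite ge0_integralZl// ?integral_indic//.
  by rewrite setIT [mu N]N0 mule0 adde0.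
apply: le_integral_nonmeasurable => x _.
  by rewrite adde_ge0// mule_ge0// lee_fin.
rewrite indicE; have [xN|xN] := boolP (x \in N).
  by rewrite mule1 addey ?leey// gt_eqF// (lt_le_trans (ltNyr 0)).
rewrite mule0 adde0; apply: contrapT => fhx.
by move: xN; rewrite notin_setE; apply; exact: fhN.
Qed.

End IntegralMonotone.

(** * Lebesgue measure of boxes and cubes *)

Lemma esumZl (R : realType) (T : choiceType) (I : set T) (a : T -> R) (c : R) :
  0 <= c -> (forall i, 0 <= a i) ->
  (\esum_(i in I) (c * a i)%:E = c%:E * \esum_(i in I) (a i)%:E)%E.
Proof.
rewrite le_eqVlt => /predU1P[<-|c0] a0.
  by rewrite mul0e esum1// => i _; rewrite mul0r.
have le b (k : R) : 0 < k -> (forall i, 0 <= b i) ->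
    (\esum_(i in I) (k * b i)%:E <= k%:E * \esum_(i in I) (b i)%:E)%E.
  move=> k0 b0; apply: ge_ereal_sup => _ [X [finX XI] <-].
  under eq_fsbigr do rewrite EFinM.
  rewrite -ge0_mule_fsumr; last by move=> i; rewrite lee_fin.
  by rewrite lee_pmul2l//; apply: esum_ge; exists X.
apply/eqP; rewrite eq_le le//= -lee_pdivlMl//.
rewrite (eq_esum (b := fun i => (c^-1 * (c * a i))%:E)); last first.
  by move=> i _; rewrite mulKf ?gt_eqF.
by apply: le; rewrite ?invr_gt0// => i; rewrite mulr_ge0 ?(ltW c0).
Qed.

Section LebesgueRV.
Context {R : realType} {n : nat}.
Local Notation mu := (lebesgue_measure_rV R n).
Implicit Types (B : 'rV[R]_n * 'rV[R]_n) (X : set 'rV[R]_n).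

(** The two parts of a box cut by the hyperplane x_i = c; when one of them is empty
its bounds are reversed, so that its volume is 0. *)
Definition clip_hi (i : 'I_n) (c : R) B : 'rV[R]_n * 'rV[R]_n :=
  (B.1, \row_j (if j == i then Num.min (B.2 ord0 j) c else B.2 ord0 j)).
Definition clip_lo (i : 'I_n) (c : R) B : 'rV[R]_n * 'rV[R]_n :=
  (\row_j (if j == i then Num.max (B.1 ord0 j) c else B.1 ord0 j), B.2).

Lemma box_volume_clip i c B :
  box_volume (clip_hi i c B) + box_volume (clip_lo i c B) = box_volume B.
Proof.
rewrite /box_volume (bigD1 i)//= [X in _ + X](bigD1 i)//= [RHS](bigD1 i)//=.
rewrite !mxE eqxx.
pose len j := Num.max 0 (B.2 ord0 j - B.1 ord0 j).
rewrite [X in _ * X + _](eq_bigr len); last by move=> j /negbTE ji; rewrite mxE ji.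
rewrite [X in _ + _ * X](eq_bigr len); last by move=> j /negbTE ji; rewrite mxE ji.
rewrite -mulrDl; congr (_ * _).
move: (B.1 ord0 i) (B.2 ord0 i) => a b; rewrite !maxEle !minEle.
by repeat case: ifPn; rewrite -?ltNge; lra.
Qed.

(** Caratheodory's criterion holds because the hyperplane x_i = c cuts every
covering box into two boxes with the same total volume.  Open and closed
half-spaces are treated together, the two pieces being closed boxes anyway. *)
Lemma measurable_halfspace (i : 'I_n) (c : R) (H : set 'rV[R]_n) :
  [set x : 'rV[R]_n | x ord0 i < c] `<=` H ->
  H `<=` [set x : 'rV[R]_n | x ord0 i <= c] ->
  measurable (H : set (lebesgue_rV R n)).
Proof.
move=> ltH Hle; apply: le_caratheodory_measurable => X.
apply: le_ereal_inf_tmp => _ [D [B [XB ->]]].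
rewrite (eq_esum (b := fun k => ((box_volume (clip_hi i c (B k)))%:E +
    (box_volume (clip_lo i c (B k)))%:E)%E)); last first.
  by move=> k _; rewrite -EFinD box_volume_clip.
rewrite esumD; try by move=> k _; rewrite lee_fin box_volume_ge0.
apply: leeD; apply: ereal_inf_lbound.
  exists D, (fun k => clip_hi i c (B k)); split => // x [/XB[k Dk xk] /Hle/= xc].
  exists k => // j; rewrite /= !mxE; case: eqP => [->|_]; last exact: xk.
  by rewrite le_min xc andbT; exact: xk.
exists D, (fun k => clip_lo i c (B k)); split => // x [/XB[k Dk xk] Hx].
have xc : c <= x ord0 i by rewrite leNgt; apply/negP => xc; exact/Hx/ltH.
exists k => // j; rewrite /= !mxE; case: eqP => [->|_]; last exact: xk.
by rewrite ge_max xc andbT; exact: xk.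
Qed.

Lemma measurable_box B : measurable (box B : set (lebesgue_rV R n)).
Proof.
have -> : box B = \bigcap_(i in [set: 'I_n])
    ([set x : 'rV[R]_n | x ord0 i <= B.2 ord0 i] `\`
     [set x : 'rV[R]_n | x ord0 i < B.1 ord0 i]).
  apply/seteqP; split => x.
    move=> Bx i _; have /andP[lo hi] := Bx i.
    by split => //=; apply/negP; rewrite -leNgt.
  by move=> Bx i; have [/= hi /negP lo] := Bx i I; rewrite leNgt lo.
apply: fin_bigcap_measurable => // i _; apply: measurableD.
  by apply: (@measurable_halfspace i (B.2 ord0 i)) => x /= // /ltW.
by apply: (@measurable_halfspace i (B.1 ord0 i)) => x /= // /ltW.
Qed.

Lemma lebesgue_box_le B : (mu (box B) <= (box_volume B)%:E)%E.
Proof.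
apply: ereal_inf_lbound; exists [set 0%N], (fun=> B).
split; first by rewrite bigcup_set1.
by rewrite esum_set1 ?lee_fin ?box_volume_ge0.
Qed.

Lemma lebesgue_outer_scale (c : R) X : 0 < c ->
  (lebesgue_outer [set c *: x | x in X] <= (c ^+ n)%:E * lebesgue_outer X)%E.
Proof.
move=> c0; have cn0 : 0 < c ^+ n by rewrite exprn_gt0.
rewrite -lee_pdivrMl//; apply: le_ereal_inf_tmp => _ [D [B [XB ->]]].
rewrite lee_pdivrMl//; apply: ereal_inf_lbound.
have volE k : box_volume (c *: (B k).1, c *: (B k).2) = c ^+ n * box_volume (B k).
  have -> : c ^+ n = \prod_(i < n) c by rewrite prodr_const card_ord.
  rewrite /box_volume -big_split/=.
  by apply: eq_bigr => i _; rewrite !mxE -mulrBr maxr_pMr ?mulr0 ?(ltW c0).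
exists D, (fun k => (c *: (B k).1, c *: (B k).2)); split.
  move=> _ [x /XB[k Dk xk] <-]; exists k => // i; rewrite /= !mxE.
  by rewrite !ler_pM2l//; exact: xk.
rewrite -esumZl ?(ltW cn0)//; last by move=> k; exact: box_volume_ge0.
by apply: eq_esum => k _; rewrite volE.
Qed.

Lemma lebesgue_cube_double (r : R) :
  (mu (cube (2 * r)) <= (2 ^+ n)%:E * mu (cube r))%E.
Proof.
apply: le_trans (lebesgue_outer_scale _ _) => //.
apply: le_lebesgue_outer => x /cubeP xr; exists (2^-1 *: x).
  apply/cubeP => i; rewrite mxE normrM gtr0_norm// ler_pdivrMl//.
by rewrite scalerA divff// scale1r.
Qed.

Lemma lebesgue_cube_le (r : R) : 0 <= r -> (mu (cube r) <= ((2 * r) ^+ n)%:E)%E.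
Proof.
move=> r0; apply: (le_trans (lebesgue_box_le _)); rewrite lee_fin /box_volume.
rewrite (eq_bigr (fun=> 2 * r)) ?prodr_const ?card_ord// => i _.
by rewrite !mxE max_r opprK; [rewrite mulr2n mulrDl mul1r|rewrite addr_ge0].
Qed.

End LebesgueRV.

(** * The Keller-Osserman condition *)

Section Growth.
Context {R : realType}.
Variables (m : nat) (g : R -> R).
Hypothesis m_ge1 : (1 <= m)%N.
Hypothesis g_nondecreasing : {in `[0, +oo[ &, {homo g : x y / x <= y}}.
Hypothesis g_gt0 : forall z, 0 < z -> 0 < g z.

Definition mroot (x : R) : R := x `^ m%:R^-1.

Lemma mroot_ge0 x : 0 <= mroot x. Proof. exact: powR_ge0. Qed.

Lemma mrootK x : 0 <= x -> mroot x ^+ m = x.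
Proof.
move=> x0; rewrite -powR_mulrn ?mroot_ge0// /mroot -powRrM mulVf ?powRr1//.
by rewrite pnatr_eq0 -lt0n.
Qed.

Let g_le x y : 0 <= x -> x <= y -> g x <= g y.
Proof.
by move=> x0 xy; apply: g_nondecreasing; rewrite ?in_itv/= ?andbT// (le_trans x0).
Qed.

Let rootm := (m%:R^-1 : R).
Let rootm_gt0 : 0 < rootm. Proof. by rewrite invr_gt0 ltr0n. Qed.
Let rootm_le1 : rootm <= 1. Proof. by rewrite invf_le1 ?ltr0n// ler1n. Qed.

Let F (t : R) : R := g t `^ (- rootm) * t `^ (rootm - 1).

Let powRN_decr (s x y : R) : 0 <= s -> 0 < x -> x <= y -> y `^ (- s) <= x `^ (- s).
Proof.
move=> s0 x0 xy; rewrite -mulN1r !powRrM !powR_inv1 ?(ltW x0) ?(le_trans (ltW x0))//.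
have y0 := lt_le_trans x0 xy.
apply: ge0_ler_powR => //; rewrite ?nnegrE ?invr_ge0 ?(ltW x0) ?(ltW y0)//.
by rewrite lef_pV2.
Qed.

Let F_decr t Z : 0 < t -> t <= Z -> F Z <= F t.
Proof.
move=> t0 tZ; apply: ler_pM; rewrite ?powR_ge0//.
  by apply: powRN_decr; [exact: ltW|exact: g_gt0|exact/g_le/tZ/ltW].
by rewrite -opprB; apply: powRN_decr; rewrite // subr_ge0.
Qed.

Let F_root Z : 0 < Z -> F Z * (Z / 2) = mroot (Z / g Z) / 2.
Proof.
move=> Z0; have gZ0 := g_gt0 Z0; rewrite mulrA; congr (_ / _).
rewrite /F -mulrA [_ * Z]mulrC mulr_powRB1 ?ltW// /mroot powRM ?invr_ge0 ?ltW//.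
rewrite mulrC; congr (_ * _).
by rewrite -mulN1r powRrM powR_inv1// ltW.
Qed.

Let dy (z : R) (j : nat) := 2 ^+ j * z.

(* The dyadic step function lies below F; the intervals being disjoint, the
   induction on N only has to remember where the last one ends. *)
Let dyadic_pointwise (z t : R) N : 1 <= z -> 1 <= t ->
  \sum_(j < N) F (dy z j.+1) * \1_(`[dy z j, dy z j.+1[%classic) t <=
  if t < dy z N then F t else 0.
Proof.
move=> z1 t1; have t0 := lt_le_trans ltr01 t1.
have F0 s : 0 <= F s by rewrite mulr_ge0 ?powR_ge0.
elim: N => [|N IH]; first by rewrite big_ord0; case: ifP.
have dyS : dy z N <= dy z N.+1.
  by rewrite ler_wpM2r ?(le_trans ler01)// ler_eXn2l ?ltr1n.
rewrite big_ord_recr/= indicE mem_setE in_itv/=.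
case: (ltP t (dy z N)) IH => tN IH.
  by rewrite (lt_le_trans tN dyS) mulr0 addr0.
case: ltP => tN1 /=; last by rewrite mulr0 addr0.
rewrite mulr1 -[leRHS]add0r lerD//.
by apply: F_decr => //; exact: ltW.
Qed.

Hypothesis g_integral : (\int[lebesgue_measure]_(z in `[1%R, +oo[)
     (g z `^ (- m%:R^-1) * z `^ (m%:R^-1 - 1))%:E < +oo)%E.

(** F being nonincreasing, its integral over [Z / 2, Z] is at least F(Z) Z / 2,
which is half the m-th root of Z / g(Z); the sum over dyadic Z is therefore
controlled by the convergent integral.  This is the only form in which the
Keller-Osserman condition is used. *)
Lemma dyadic_sum_bounded : exists2 I : R, 0 <= I & forall z, 1 <= z -> forall N,
  \sum_(j < N) mroot (2 ^+ j.+1 * z / g (2 ^+ j.+1 * z)) <= I.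
Proof.
move: (g_integral); set J := (X in (X < _)%E) => Joo.
have J0 : (0 <= J)%E.
  by apply: integral_ge0 => t _; rewrite lee_fin mulr_ge0 ?powR_ge0.
have Jfin : J \is a fin_num by rewrite ge0_fin_numE.
exists (2 * fine J); first by rewrite mulr_ge0// fine_ge0.
move=> z z1 N; have z0 := lt_le_trans ltr01 z1.
change (\sum_(j < N) mroot (dy z j.+1 / g (dy z j.+1)) <= 2 * fine J).
have dy0 j : 0 < dy z j by rewrite mulr_gt0// exprn_gt0.
have dyS j : dy z j.+1 = 2 * dy z j by rewrite /dy exprS mulrA.
have dy1 j : 1 <= dy z j.
  by rewrite mulr_ege1// exprn_ege1// ler1n.
rewrite mulrC -ler_pdivrMr// mulr_suml -lee_fin fineK//.
pose I_ j := `[dy z j, dy z j.+1[%classic.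
have -> : (\sum_(j < N) mroot (dy z j.+1 / g (dy z j.+1)) / 2)%:E =
  (\int[lebesgue_measure]_(t in `[1%R, +oo[)
     (\sum_(j < N) (F (dy z j.+1))%:E * (\1_(I_ j) t)%:E))%E.
  rewrite ge0_integral_sum//; last 2 first.
  - move=> j; apply: measurable_funeM.
    by apply/measurable_EFinP; apply: measurable_indic; exact: measurable_itv.
  - by move=> j t _; rewrite mule_ge0// lee_fin mulr_ge0 ?powR_ge0.
  rewrite -sumEFin; apply: eq_bigr => j _.
  rewrite ge0_integralZl//; last 2 first.
  - by apply/measurable_EFinP; apply: measurable_indic; exact: measurable_itv.
  - by rewrite lee_fin mulr_ge0 ?powR_ge0.
  rewrite integral_indic//; last exact: measurable_itv.
  have -> : I_ j `&` `[1%R, +oo[%classic = I_ j.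
    apply/setIidPl => t; rewrite /I_ /= !in_itv/= andbT => /andP[+ _].
    exact: le_trans.
  rewrite -F_root// EFinM; congr (_ * _)%E; apply: esym.
  rewrite [LHS]lebesgue_measure_itv/= lte_fin dyS ltr_pMl// ltr1n -EFinB.
  by congr _%:E; field.
apply: le_integral_nonmeasurable => t; rewrite /= in_itv/= andbT => t1.
  by rewrite lee_fin mulr_ge0 ?powR_ge0.
under eq_bigr do rewrite -EFinM.
rewrite sumEFin lee_fin (le_trans (dyadic_pointwise N z1 t1))//.
by case: ifP => //; rewrite mulr_ge0 ?powR_ge0.
Qed.

(** A single term of the dyadic sum already gives z <= I ^ m g(z) for z >= 2, and
on [e, 2] the positive lower bound g(e) is enough. *)
Lemma superlinear_bound : (forall z, 0 <= z -> 0 <= g z) ->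
  forall e, 0 < e -> exists2 c, 0 <= c & forall z, 0 <= z -> z <= e + c * g z.
Proof.
move=> g_ge0 e e0; have [I I0 HI] := dyadic_sum_bounded.
have ge := g_gt0 e0.
have Im0 : 0 <= I ^+ m by exact: exprn_ge0.
exists (I ^+ m + 2 / g e); first by rewrite addr_ge0// divr_ge0 ?ltW.
move=> z z0; have gz0 := g_ge0 z z0.
have [ze|/ltW ez] := leP z e.
  by rewrite (le_trans ze)// lerDl mulr_ge0// addr_ge0// divr_ge0 ?ltW.
rewrite (@le_trans _ _ ((I ^+ m + 2 / g e) * g z))//; last by rewrite lerDr ltW.
have gez : g e <= g z by apply: g_le => //; exact: ltW.
rewrite mulrDl; have [z2|/ltW z2] := leP z 2.
  rewrite (le_trans z2)// (@le_trans _ _ (2 / g e * g z))//; last first.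
    by rewrite lerDr mulr_ge0.
  by rewrite -mulrA ler_pMr// mulrC ler_pdivlMr ?mul1r.
have z12 : 1 <= z / 2 by rewrite ler_pdivlMr ?mul1r.
have := HI _ z12 1%N; rewrite big_ord1 expr1 [2 * _]mulrC divfK// => rI.
have gz : 0 < g z by rewrite (lt_le_trans ge).
rewrite (@le_trans _ _ (I ^+ m * g z))//; last first.
  by rewrite lerDl mulr_ge0// divr_ge0// ltW.
rewrite -ler_pdivrMr// -[leLHS]mrootK ?divr_ge0//.
by apply: lerXn2r => //; rewrite nnegrE ?mroot_ge0.
Qed.

End Growth.

(** * Convex functions on the half-line *)

Section Convexity.
Context {R : realType}.
Variable g : R -> R.
Hypothesis g_convex : convex_function (`[0, +oo[%classic : set R^o) g.

Lemma convex_chord (a b t : R) : 0 <= a -> 0 <= b -> 0 <= t <= 1 ->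
  g (t * a + (1 - t) * b) <= t * g a + (1 - t) * g b.
Proof.
move=> a0 b0 /andP[t0 t1].
have := @g_convex (Itv01 t0 t1) a b.
by rewrite !inE/= !in_itv/= !andbT a0 b0; exact.
Qed.

Lemma convex_slope (s t z : R) : 0 <= s -> s < t -> t < z ->
  (g t - g s) / (t - s) <= (g z - g t) / (z - t).
Proof.
move=> s0 st tz; have sz := lt_trans st tz.
have zs : 0 < z - s by rewrite subr_gt0.
have t01 : 0 <= (z - t) / (z - s) <= 1.
  apply/andP; split; first by apply: divr_ge0; rewrite subr_ge0 ltW.
  by rewrite ler_pdivrMr// mul1r lerD2l lerN2 ltW.
have := convex_chord s0 (ltW (le_lt_trans s0 sz)) t01.
have -> : (z - t) / (z - s) * s + (1 - (z - t) / (z - s)) * z = t.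
  by field; rewrite gt_eqF.
rewrite -(ler_pM2r zs).
have -> : ((z - t) / (z - s) * g s + (1 - (z - t) / (z - s)) * g z) * (z - s) =
   (z - t) * g s + (t - s) * g z by field; rewrite gt_eqF.
move=> h; rewrite ler_pdivrMr ?subr_gt0// mulrAC ler_pdivlMr ?subr_gt0//.
by move: h; lra.
Qed.

(** The slope is the supremum of the slopes of the chords ending at t, that is, the
left derivative of g at t. *)
Lemma convex_support_line (t : R) : 0 < t ->
  {in `[0, +oo[ &, {homo g : x y / x <= y}} ->
  exists2 p, 0 <= p & forall z, 0 <= z -> g t + p * (z - t) <= g z.
Proof.
move=> t0 nd; pose S := [set (g t - g s) / (t - s) | s in `[0, t[%classic].
have S0 : S (g t / t - g 0 / t) .
  by exists 0; rewrite /= ?in_itv/= ?lexx// !subr0 mulrBl.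
have ubS z : t < z -> ubound S ((g z - g t) / (z - t)).
  move=> tz _ [s /= + <-]; rewrite in_itv/= => /andP[s0 st]; exact: convex_slope.
have hubS : has_ubound S.
  by exists ((g (t + 1) - g t) / (t + 1 - t)); apply: ubS; rewrite ltrDl.
exists (sup S) => [|z z0].
  apply: le_trans (ub_le_sup hubS S0).
  rewrite -mulrBl divr_ge0 ?(ltW t0)// subr_ge0.
  by apply: nd; rewrite ?in_itv/= ?lexx ?(ltW t0).
have [zt|tz|->] := ltgtP z t; last by rewrite subrr mulr0 addr0.
  have : (g t - g z) / (t - z) <= sup S.
    by apply: ub_le_sup => //; exists z => //=; rewrite in_itv/= z0.
  by rewrite ler_pdivrMr ?subr_gt0//; lra.
have : sup S <= (g z - g t) / (z - t).
  by apply: ge_sup; [exists (g t / t - g 0 / t)|exact: ubS].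
by rewrite ler_pdivlMr ?subr_gt0//; lra.
Qed.

(** Were g 0 negative, the chord of g from 0 to 1 would vanish at some t > 0, where
convexity would give g t <= 0. *)
Lemma convex_ge0 : (forall z, 0 < z -> 0 < g z) -> forall z, 0 <= z -> 0 <= g z.
Proof.
move=> g_gt0 z; rewrite le_eqVlt => /predU1P[<-|/g_gt0/ltW//].
rewrite leNgt; apply/negP => g0.
have g1 := g_gt0 1 ltr01.
have d0 : 0 < g 1 - g 0 by lra.
pose t := - g 0 / (g 1 - g 0).
have t0 : 0 < t by rewrite divr_gt0// oppr_gt0.
have t1 : t <= 1 by rewrite ler_pdivrMr// mul1r; lra.
have := @convex_chord 1 0 t ler01 (lexx _).
rewrite (ltW t0) t1 mulr1 mulr0 addr0 => /(_ isT).
have -> : t * g 1 + (1 - t) * g 0 = 0 by rewrite /t; field; rewrite gt_eqF.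
by rewrite leNgt g_gt0.
Qed.

End Convexity.

(** * The blow-up iteration *)

(** The facts about a solution u that lead to its vanishing, as a statement on
functions of the radius r of a cube: E is the integral of |u|, G that of g(|u|)
and V the volume. *)
Section Energy.
Context {R : realType}.
Variables (m n : nat) (g E G V : R -> R) (C L : R).
Hypothesis m_ge1 : (1 <= m)%N.
Hypothesis m_ge_n : (n <= m)%N.
Hypothesis C_gt0 : 0 < C.
Hypothesis g_gt0 : forall z, 0 < z -> 0 < g z.
Hypothesis L_ge0 : 0 <= L.
Hypothesis dyadic : forall N,
  \sum_(j < N) mroot m (2 ^+ j.+1 / g (2 ^+ j.+1)) <= L.
Hypothesis g_linear : forall e, 0 < e -> exists2 c, 0 <= c &
  forall r, 0 <= r -> E r <= e * V r + c * G r.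
Hypothesis E_le : forall r s, 0 <= r -> r <= s -> E r <= E s.
Hypothesis G_le : forall r s, 0 <= r -> r <= s -> G r <= G s.
Hypothesis V_le : forall r s, 0 <= r -> r <= s -> V r <= V s.
Hypothesis V_ge0 : forall r, 0 <= V r.
Hypothesis V_double : forall r, 0 <= r -> V (2 * r) <= 2 ^+ n * V r.
Hypothesis V_volume : forall r, 0 <= r -> V r <= (2 * r) ^+ n.
Hypothesis E_null : forall r, 0 <= r -> V r = 0 -> E r = 0.
Hypothesis capacity : forall r d, 0 <= r -> 0 < d -> d ^+ m * G r <= C * E (r + d).
Hypothesis jensen : forall r t, 0 <= r -> 0 < t -> t * V r <= E r -> g t * V r <= G r.

Local Notation kappa := (mroot m (C * 2 ^+ n.+1)).
(* kappa and delta are chosen so that the radius increment delta j doubles the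
   lower bound zeta j on the mean energy; the extra factor 2 ^ n in kappa pays
   for comparing V (2 r) with the volume V (rad j) of a smaller cube. *)
Let kappaE : kappa ^+ m = C * 2 ^+ n.+1.
Proof. by rewrite mrootK// mulr_ge0 ?exprn_ge0// ltW. Qed.

Let zeta j : R := 2 ^+ j.+1.
Let zeta_gt0 j : 0 < zeta j. Proof. by rewrite exprn_gt0. Qed.
Let delta j := kappa * mroot m (zeta j / g (zeta j)).

Let delta_gt0 j : 0 < delta j.
Proof.
have pos x : 0 < x -> 0 < mroot m x by exact: powR_gt0.
rewrite mulr_gt0// pos//; first by rewrite mulr_gt0// exprn_gt0.
by rewrite divr_gt0// g_gt0.
Qed.

Let deltaX j : delta j ^+ m * g (zeta j) = C * 2 ^+ n.+1 * zeta j.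
Proof.
have gz := g_gt0 (zeta_gt0 j).
by rewrite exprMn kappaE mrootK ?divr_ge0 ?(ltW gz)// ?ltW// mulrA divfK ?gt_eqF.
Qed.

(** The blow-up argument.  If the energy per unit volume exceeds 2 ^ n.+1 at radius
r, then capacity and Jensen force the lower bound zeta j on E (rad j) / V (2 r) to
double between rad j and rad j.+1 = rad j + delta j.  The increments delta j have sum at most kappa * L <= r, so all
the radii stay below 2 r while the energy, monotone in the radius, is unbounded:
a contradiction. *)
Lemma mean_growth_bounded r : 0 <= r -> kappa * L <= r -> E r <= 2 ^+ n.+1 * V r.
Proof.
move=> r0 rL; rewrite leNgt; apply/negP => VE.
pose W := V (2 * r); pose rad j := r + \sum_(i < j) delta i.
have V0 : 0 < V r.
  rewrite lt_neqAle V_ge0 andbT; apply/eqP => /esym Vr0.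
  by move: VE; rewrite Vr0 mulr0 E_null// ltxx.
have r2 : r <= 2 * r by rewrite mulr2n mulrDl mul1r lerDl.
have W0 : 0 < W by rewrite (lt_le_trans V0)// V_le.
have r_rad j : r <= rad j by rewrite lerDl sumr_ge0// => i _; exact: ltW.
have rad_le j : rad j <= 2 * r.
  rewrite mulr2n mulrDl mul1r lerD2l (le_trans _ rL)// -mulr_sumr ler_wpM2l//.
  exact: mroot_ge0.
have rad0 j : 0 <= rad j by exact: le_trans (r_rad j).
have growth j : zeta j * W <= E (rad j).
  elim: j => [|j IH].
    rewrite /rad big_ord0 addr0 (le_trans _ (ltW VE))// /zeta expr1.
    by rewrite exprS -mulrA ler_wpM2l// V_double.
  have VW : V (rad j) <= W by apply: V_le.
  have J : g (zeta j) * V (rad j) <= G (rad j).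
    apply: jensen => //; apply: le_trans IH; apply: ler_wpM2l => //; exact: ltW.
  have radS : rad j.+1 = rad j + delta j by rewrite /rad big_ord_recr/= addrA.
  have := capacity (rad0 j) (delta_gt0 j); rewrite -radS.
  have dm0 : 0 <= delta j ^+ m by rewrite exprn_ge0// ltW.
  move=> /(le_trans (ler_wpM2l dm0 J)); rewrite mulrA deltaX.
  have -> : C * 2 ^+ n.+1 * zeta j * V (rad j) =
      C * (zeta j * 2 * (2 ^+ n * V (rad j))).
    by rewrite exprS; ring.
  rewrite ler_pM2l//; apply: le_trans.
  have -> : zeta j.+1 = zeta j * 2 by rewrite /zeta exprSr.
  rewrite ler_wpM2l ?mulr_ge0 ?(ltW (zeta_gt0 j))//.
  by apply: (le_trans (V_double r0)); rewrite ler_wpM2l ?exprn_ge0// V_le.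
have [k kE] : exists k : nat, E (2 * r) / W < k%:R.
  exists (Num.truncn (E (2 * r) / W)).+1.
  exact: truncnS_gt.
move: kE; rewrite ltr_pdivrMr// ltNge => /negP; apply; apply: ltW.
apply: lt_le_trans (E_le (rad0 k) (rad_le k)).
apply: lt_le_trans (growth k); rewrite ltr_pM2r// /zeta -natrX ltr_nat.
by rewrite (leq_trans (ltn_expl k (isT : (1 < 2)%N)))// leq_exp2l.
Qed.

(** Once the mean energy is bounded, the capacity estimate with d = r bounds G by a
constant B because n <= m.  Feeding this back through E <= e V + c G makes the
right-hand side of the same estimate O(e) + O(1 / r), so G vanishes; the second
pass is needed when m = n, where the first one gives no decay. *)
Lemma energy_vanishes r : 0 <= r -> G r <= 0.
Proof.
move=> r0.
have kL0 : 0 <= kappa * L by rewrite mulr_ge0// mroot_ge0.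
pose rho := 1 + kappa * L.
have rho1 : 1 <= rho by rewrite lerDl.
(* An affine bound on the energy at radius 2 s decays under the capacity estimate
   with d = s: the volume term stays bounded since n <= m, the constant one is
   divided by at least s. *)
have decay s e c : rho <= s -> 0 <= e -> 0 <= c -> E (2 * s) <= e * V (2 * s) + c ->
    G s <= C * (4 ^+ n * e + c / s).
  move=> rs e0 c0 Ese; have s1 : 1 <= s by exact: le_trans rs.
  have s0 : 0 < s by exact: lt_le_trans s1.
  have sm0 : 0 < s ^+ m by rewrite exprn_gt0.
  have := capacity (ltW s0) s0; rewrite mulrC -ler_pdivlMr// => /le_trans; apply.
  rewrite -mulrA ler_pM2l// ler_pdivrMr//.
  have -> : s + s = 2 * s by rewrite mulr2n mulrDl mul1r.
  apply: (le_trans Ese); rewrite [leRHS]mulrDl lerD//.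
    rewrite [4 ^+ n * e]mulrC -[leRHS]mulrA ler_wpM2l//.
    apply: (@le_trans _ _ ((2 * (2 * s)) ^+ n)).
      by apply: V_volume; rewrite mulr_ge0// ltW.
    have -> : 2 * (2 * s) = 4 * s by rewrite mulrA -natrM.
    by rewrite exprMn ler_pM2l ?exprn_gt0// ler_weXn2l.
  rewrite -mulrA ler_peMr// -(prednK m_ge1) exprS mulKf ?gt_eqF//.
  exact: exprn_ege1.
pose B := C * (4 ^+ n * 2 ^+ n.+1).
have GB s : 0 <= s -> G s <= B.
  move=> s0; apply: (@le_trans _ _ (G (Num.max s rho))).
    by apply: G_le => //; rewrite le_max lexx.
  have rs : rho <= Num.max s rho by rewrite le_max lexx orbT.
  have s'0 : 0 <= Num.max s rho by rewrite le_max s0.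
  apply: le_trans (decay _ (2 ^+ n.+1) 0 rs _ (lexx 0) _) _; rewrite ?exprn_ge0//.
    rewrite addr0 mean_growth_bounded//; first by rewrite mulr_ge0.
    rewrite (@le_trans _ _ rho)// ?lerDr// (le_trans rs)// mulr2n mulrDl mul1r lerDl//.
  by rewrite mul0r addr0.
apply/ler_addgt0Pl => eta eta0; rewrite addr0.
pose e := eta / (2 * C * 4 ^+ n).
have K0 : 0 < 2 * C * 4 ^+ n by rewrite !mulr_gt0 ?exprn_gt0.
have e0 : 0 < e by rewrite divr_gt0.
have [c c0 Hc] := g_linear e0.
have B0 : 0 <= B by rewrite !mulr_ge0 ?exprn_ge0// ltW.
pose s := r + rho + 2 * C * (c * B) / eta.
have q0 : 0 <= 2 * C * (c * B) / eta by rewrite divr_ge0 ?mulr_ge0// ltW.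
have rs : rho <= s by rewrite /s -addrA addrCA lerDl addr_ge0.
have s0 : 0 < s by rewrite (lt_le_trans _ rs)// (lt_le_trans ltr01).
have r_s : r <= s by rewrite /s -addrA lerDl addr_ge0// (le_trans ler01).
apply: (le_trans (G_le r0 r_s)).
have s20 : 0 <= 2 * s by rewrite mulr_ge0// ltW.
have Es : E (2 * s) <= e * V (2 * s) + c * B.
  by apply: (le_trans (Hc _ s20)); rewrite lerD2l ler_wpM2l// GB.
apply: (le_trans (decay s e (c * B) rs (ltW e0) (mulr_ge0 c0 B0) Es)).
rewrite mulrDr.
have -> : C * (4 ^+ n * e) = eta / 2.
  by rewrite /e; field; rewrite gt_eqF//= gt_eqF// exprn_gt0.
suff : C * (c * B / s) <= eta / 2 by lra.
rewrite mulrA ler_pdivrMr//.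
have : 2 * C * (c * B) / eta <= s by rewrite /s lerDr addr_ge0// (le_trans ler01).
rewrite ler_pdivrMr//; lra.
Qed.

End Energy.

(** * Jensen's inequality *)

Section AffineIntegral.
Local Open Scope ereal_scope.
Context d (T : measurableType d) (R : realType).
Variable mu : {measure set T -> \bar R}.
Variables (D : set T) (mD : measurable D).
Implicit Types f h : T -> R.

Lemma ge0_integral_affine (b c : R) f : (0 <= b)%R -> (0 <= c)%R ->
  measurable_fun D f -> (forall x, D x -> 0 <= f x)%R ->
  \int[mu]_(x in D) (b + c * f x)%:E =
  b%:E * mu D + c%:E * \int[mu]_(x in D) (f x)%:E.
Proof.
move=> b0 c0 mf f0.
rewrite (eq_integral (fun x => b%:E + c%:E * (f x)%:E)); last first.
  by move=> x _; rewrite EFinD EFinM.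
have mf' : measurable_fun D (fun x => (f x)%:E) by exact/measurable_EFinP.
rewrite ge0_integralD//; last 2 first.
- by move=> x Dx; rewrite mule_ge0// lee_fin// f0.
- exact: measurable_funeM.
by rewrite integral_cst// ge0_integralZl.
Qed.

(** Integrate over D the inequality g(t) + p (f - t) <= g(f), written with p t on
the other side so that only nonnegative functions are integrated, then cancel
p t mu(D). *)
Lemma jensen_support_line (g : R -> R) (f : T -> R) (t p : R) :
  (0 <= t)%R -> (0 <= p)%R -> (forall z, 0 <= z -> g t + p * (z - t) <= g z)%R ->
  (forall z, 0 <= z -> 0 <= g z)%R ->
  measurable_fun D f -> measurable_fun D (g \o f) ->
  (forall x, D x -> 0 <= f x)%R -> mu D < +oo ->
  t%:E * mu D <= \int[mu]_(x in D) (f x)%:E ->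
  (g t)%:E * mu D <= \int[mu]_(x in D) (g (f x))%:E.
Proof.
move=> t0 p0 line g0 mf mgf f0 Doo tf.
have le : \int[mu]_(x in D) (g t + p * f x)%:E <=
    \int[mu]_(x in D) (p * t + 1 * g (f x))%:E.
  apply: le_integral_nonmeasurable => x Dx; rewrite lee_fin.
    by rewrite addr_ge0 ?mulr_ge0// g0// f0.
  by have := line _ (f0 x Dx); lra.
have gt0 := g0 t t0; have pt0 := mulr_ge0 p0 t0.
rewrite !ge0_integral_affine// in le; last by move=> x Dx; rewrite g0// f0.
have Dfin : mu D \is a fin_num by rewrite ge0_fin_numE.
rewrite mul1e [leRHS]addeC in le.
have : (g t)%:E * mu D + (p * t)%:E * mu D <=
    \int[mu]_(x in D) (g (f x))%:E + (p * t)%:E * mu D.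
  apply: le_trans le; rewrite leeD2l//.
  by rewrite EFinM -muleA lee_wpmul2l.
by rewrite leeD2rE// fin_numM.
Qed.

End AffineIntegral.

(** * Weak solutions *)

Section WeakSolution.
Context {R : realType} {m n : nat}.
Local Notation mu := (lebesgue_measure_rV R n).
Variables (a : {ffun 'I_n -> 'I_m.+1} -> 'rV[R]_n -> R -> R) (A : R) (g : R -> R)
  (u : 'rV[R]_n -> R).
Hypothesis A_gt0 : 0 < A.
Hypothesis a_bound : forall alpha, multi_order alpha = m ->
     \forall x \ae lebesgue_measure_rV R n,
       forall z : R, `|a alpha x z| <= A * `|z|.
Hypothesis g_ge0 : forall z, 0 <= z -> 0 <= g z.
Hypothesis u_solution : global_weak_solution a g u.

Let mu_abs D : measurable_fun D ((fun x => `|u x|) : lebesgue_rV R n -> R).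
Proof.
case: u_solution => -[mu_u _] _ _; apply: (@measurable_funTS _ _ (lebesgue_rV R n)).
by apply: measurableT_comp => //; exact: mu_u.
Qed.

Let mcube r : measurable (cube r : set (lebesgue_rV R n)).
Proof. exact: measurable_box. Qed.

Let ae_filter : Filter (nbhs (almost_everywhere mu)).
Proof. exact: (ae_filter_ringOfSetsType mu). Qed.

(** The weak inequality tested with a cutoff of cube r supported in cube (r + d):
the side of g is at least the integral of g(|u|) over cube r, and on the other
side each of the finitely many terms is at most A |u| C0 / d ^ m in cube (r + d)
and 0 outside. *)
Lemma weak_solution_capacity : exists2 C : R, 0 < C & forall r d, 0 <= r -> 0 < d ->
  (\int[mu]_(x in cube r) (g `|u x|)%:E <=
   (C / d ^+ m)%:E * \int[mu]_(x in cube (r + d)%R) (`|u x|)%:E)%E.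
Proof.
have [C0 C00 HC] := @cutoff_exists R n m.
pose N : R := #|{ffun 'I_n -> 'I_m.+1}|%:R.
have N0 : 0 < N by rewrite ltr0n; apply/card_gt0P; exists [ffun=> ord0].
exists (N * (A * C0)); first by rewrite !mulr_gt0.
move=> r d r0 d0; have [phi [tphi phi0 phi1 phiD]] := HC r d r0 d0.
have dm0 : 0 < d ^+ m by rewrite exprn_gt0.
set K := N * (A * C0) / d ^+ m.
have K0 : 0 <= K by rewrite divr_ge0 ?ltW// !mulr_gt0.
case: u_solution => _ _ /(_ phi tphi phi0) weak.
pose Ku (x : lebesgue_rV R n) : \bar R := (K * `|u x|)%:E.
pose h (x : lebesgue_rV R n) : \bar R := (Ku \_ (cube (r + d))) x.
have mKu D : measurable_fun D Ku.
  by apply/measurable_EFinP; apply: measurable_funM => //.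
have mh : measurable_fun setT h by apply/(measurable_restrictT _ _).1.
have h0 x : (0 <= h x)%E.
  by apply: erestrict_ge0 => y _; rewrite lee_fin mulr_ge0.
have -> : (K%:E * \int[mu]_(x in cube (r + d)%R) (`|u x|)%:E = \int[mu]_x h x)%E.
  rewrite /h -integral_mkcond -ge0_integralZl//; last exact/measurable_EFinP.
apply: (@le_trans _ _ (\int[mu]_x (g `|u x| * phi x)%:E)%E).
  rewrite integral_mkcond; apply: le_integral_nonmeasurable => x _.
    by rewrite lee_fin mulr_ge0// g_ge0.
  rewrite patchE; case: ifPn => [|_]; last by rewrite lee_fin mulr_ge0// g_ge0.
  by rewrite inE => /phi1 ->; rewrite mulr1.
apply: (le_trans weak); apply: ae_le_integral_nonmeasurable => //.
have : \forall x \ae mu, forall alpha, multi_order alpha = m ->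
    forall z : R, `|a alpha x z| <= A * `|z|.
  apply: filter_forall => alpha.
  have [am|am] := pselect (multi_order alpha = m); last by apply: aeW => x.
  by apply: (@filterS _ _ ae_filter _ _ _ (a_bound am)) => x.
apply: (@filterS _ _ ae_filter) => x ax; rewrite /h patchE.
case: ifPn => xQ; last first.
  rewrite lee_fin big1// => alpha /eqP am.
  by rewrite (phiD alpha am x).2 ?mulr0//; move: xQ; rewrite notin_setE.
rewrite lee_fin (le_trans (ler_norm _))// (le_trans (ler_norm_sum _ _ _))//.
apply: (@le_trans _ _ (\sum_(alpha | multi_order alpha == m)
    A * `|u x| * (C0 / d ^+ m))).
  apply: ler_sum => alpha /eqP am; rewrite !normrM normrX normrN1 expr1n mul1r.
  by rewrite ler_pM// ?ax//; exact: (phiD alpha am x).1.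
rewrite big_mkcond/=.
apply: (@le_trans _ _ (\sum_(alpha : {ffun 'I_n -> 'I_m.+1})
    A * `|u x| * (C0 / d ^+ m))).
  apply: ler_sum => alpha _; case: ifP => // _.
  by apply: mulr_ge0; [rewrite mulr_ge0// ltW|rewrite divr_ge0// ltW].
rewrite sumr_const -mulr_natl -/N /K le_eqVlt; apply/orP; left; apply/eqP.
by ring.
Qed.

(** Cube by cube, a nonnegative function with zero integral vanishes almost
everywhere, and g only vanishes, if at all, at 0; the whole space is the union
of the cubes of integral radius. *)
Lemma weak_solution_ae0 :
  (forall z, 0 < z -> 0 < g z) ->
  (forall r, 0 <= r -> (\int[mu]_(x in cube r) (g `|u x|)%:E <= 0)%E) ->
  \forall x \ae mu, u x = 0.
Proof.
move=> g_gt0 G0; case: u_solution => _ [mgu _] _.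
have mgu' D : measurable_fun D
    ((fun x => (g `|u x|)%:E) : lebesgue_rV R n -> \bar R).
  apply: (@measurable_funTS _ _ (lebesgue_rV R n)).
  by apply/measurable_EFinP; exact: mgu.
have cube0 (k : nat) : \forall x \ae mu, cube k%:R x -> u x = 0.
  have /(ae_eq_integral_abs mu (mcube k%:R) (mgu' _)) :
      (\int[mu]_(x in cube k%:R) `|(g `|u x|)%:E| = 0)%E.
    rewrite (eq_integral (fun x : lebesgue_rV R n => (g `|u x|)%:E)); last first.
      by move=> x _; rewrite gee0_abs// lee_fin g_ge0.
    apply: le_anti; apply/andP; split; first exact: G0.
    by apply: integral_ge0 => x _; rewrite lee_fin g_ge0.
  apply: (@filterS _ _ ae_filter) => x gux Qx.
  have [//|u0] := eqVneq (u x) 0.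
  have := gux Qx; rewrite /= => -[] /eqP; rewrite gt_eqF// g_gt0// normr_gt0//.
have := ae_foralln cube0; apply: (@filterS _ _ ae_filter) => x ux.
apply: (ux (Num.truncn (\sum_i `|x ord0 i|)).+1).
apply/cubeP => i; apply: le_trans (ltW (truncnS_gt _)).
by rewrite (bigD1 i)//= lerDl sumr_ge0.
Qed.

End WeakSolution.

(** * Triviality of global weak solutions *)

Theorem theorem2p5 (R : realType) (m n : nat) (m_ge1 : (1 <= m)%N)
  (n_ge1 : (1 <= n)%N)
  (a : {ffun 'I_n -> 'I_m.+1} -> 'rV[R]_n -> R -> R)
  (a_Caratheodory : forall alpha, multi_order alpha = m ->
     Caratheodory_function (a alpha))
  (A : R) (A_gt0 : 0 < A)
  (a_bound : forall alpha, multi_order alpha = m ->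
     \forall x \ae lebesgue_measure_rV R n,
       forall z : R, `|a alpha x z| <= A * `|z|)
  (g : R -> R)
  (g_nondecreasing : {in `[0, +oo[ &, {homo g : x y / x <= y}})
  (g_convex : convex_function (`[0, +oo[%classic : set R^o) g)
  (g_gt0 : forall z, 0 < z -> 0 < g z)
  (g_integral : (\int[lebesgue_measure]_(z in `[1%R, +oo[)
     (g z `^ (- m%:R^-1) * z `^ (m%:R^-1 - 1))%:E < +oo)%E)
  (m_ge_n : (n <= m)%N)
  (u : 'rV[R]_n -> R) (u_solution : global_weak_solution a g u) :
  \forall x \ae lebesgue_measure_rV R n, u x = 0.
Proof.
set mu := lebesgue_measure_rV R n.
have g_ge0 := convex_ge0 g_convex g_gt0.
have [C C0 capacity] := weak_solution_capacity A_gt0 a_bound g_ge0 u_solution.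
have [I I0 dyadic] := dyadic_sum_bounded m_ge1 g_nondecreasing g_gt0 g_integral.
have slin := superlinear_bound m_ge1 g_nondecreasing g_gt0 g_integral g_ge0.
apply: (weak_solution_ae0 g_ge0 u_solution g_gt0).
case: (u_solution) => -[mu_u locu] [mgu locg] _.
have mcube r : measurable (cube r : set (lebesgue_rV R n)) by exact: measurable_box.
have mabs D : measurable_fun D ((fun x => `|u x|) : lebesgue_rV R n -> R).
  apply: (@measurable_funTS _ _ (lebesgue_rV R n)).
  by apply: measurableT_comp => //; exact: mu_u.
have mg D : measurable_fun D ((fun x => g `|u x|) : lebesgue_rV R n -> R).
  by apply: (@measurable_funTS _ _ (lebesgue_rV R n)); exact: mgu.
pose Ee r : \bar R := (\int[mu]_(x in cube r) (`|u x|)%:E)%E.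
pose Ge r : \bar R := (\int[mu]_(x in cube r) (g `|u x|)%:E)%E.
have Ee0 r : (0 <= Ee r)%E by apply: integral_ge0 => x _; rewrite lee_fin.
have Ge0 r : (0 <= Ge r)%E by apply: integral_ge0 => x _; rewrite lee_fin g_ge0.
have Efin r : Ee r \is a fin_num.
  by rewrite ge0_fin_numE//; exact: (locu _ (@compact_cube _ _ r)).
have Gfin r : Ge r \is a fin_num.
  rewrite ge0_fin_numE//; apply: le_lt_trans (locg _ (@compact_cube _ _ r)).
  apply: le_integral_nonmeasurable => x _; rewrite lee_fin//.
  exact: ler_norm.
have Vfin r : 0 <= r -> mu (cube r) \is a fin_num.
  by move=> r0; rewrite ge0_fin_numE// (le_lt_trans (lebesgue_cube_le r0))// ltry.
pose E r := fine (Ee r); pose G r := fine (Ge r); pose V r := fine (mu (cube r)).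
have EE r : Ee r = (E r)%:E by rewrite fineK.
have GE r : Ge r = (G r)%:E by rewrite fineK.
have VE r : 0 <= r -> mu (cube r) = (V r)%:E by move=> r0; rewrite fineK// Vfin.
suff G0 r : 0 <= r -> G r <= 0.
  by move=> r r0; rewrite -[X in (X <= _)%E]/(Ge r) GE lee_fin G0.
move=> r0.
apply: (@energy_vanishes R m n g E G V C I m_ge1 m_ge_n C0 g_gt0 I0) => //.
- by move=> N; have := dyadic 1 (lexx 1) N; under eq_bigr do rewrite mulr1.
- move=> e e0; have [c c0 Hc] := slin e e0; exists c => // s s0.
  rewrite -lee_fin EFinD !EFinM -EE -GE -VE//.
  rewrite -ge0_integral_affine//; [|exact: ltW|by move=> x _; exact: g_ge0].
  apply: le_integral_nonmeasurable => x _; rewrite lee_fin; last exact: Hc.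
  by apply: addr_ge0; [exact: ltW|rewrite mulr_ge0// g_ge0].
- move=> s t s0 st; rewrite -lee_fin -!EE.
  apply: ge0_subset_integral => //; last exact: sub_cube.
  exact/measurable_EFinP.
- move=> s t s0 st; rewrite -lee_fin -!GE.
  apply: ge0_subset_integral => //; last exact: sub_cube.
    exact/measurable_EFinP.
  by move=> x _; rewrite lee_fin g_ge0.
- move=> s t s0 st; rewrite -lee_fin -!VE// ?(le_trans s0)//.
  by apply: le_lebesgue_outer; exact: sub_cube.
- by move=> s; rewrite fine_ge0.
- move=> s s0; rewrite -lee_fin EFinM -!VE// ?mulr_ge0//.
  exact: lebesgue_cube_double.
- by move=> s s0; rewrite -lee_fin -VE// lebesgue_cube_le.
- move=> s s0 Vs0; apply: EFin_inj; rewrite -EE.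
  apply: null_set_integral => //; first exact/measurable_EFinP.
  by rewrite -[LHS]/(mu (cube s)) VE// Vs0.
- move=> s d s0 d0; have := capacity s d s0 d0.
  rewrite -[X in (X <= _)%E]/(Ge s) -[X in (_ <= _ * X)%E]/(Ee (s + d)).
  rewrite GE EE -EFinM lee_fin.
  by rewrite mulrAC ler_pdivlMr ?exprn_gt0// mulrC.
- move=> s t s0 t0 tE.
  have [p p0 line] := convex_support_line g_convex t0 g_nondecreasing.
  rewrite -lee_fin EFinM -VE// -GE.
  apply: (jensen_support_line (mcube s) (ltW t0) p0 line g_ge0) => //.
    by rewrite -ge0_fin_numE// Vfin.
  by rewrite -[leRHS]/(Ee s) EE VE// -EFinM lee_fin.
Qed.
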